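(* Let $(\Omega, S, \nu)$ be a finite non-atomic measure space, let $A \in S$ be a measurable set with $\nu(A) > 0$, let $n \ge 1$ be an integer, let $A_1, A_2, \dots, A_n \in S$ be measurable subsets of $A$, and let $m_1, m_2, \dots, m_n > 0$ be real numbers. Then there exist pairwise disjoint measurable sets $B_1, \dots, B_n \in S$ with $B_k \subseteq A_k$ and $\nu(B_k) = m_k$ for all $k \in [n]$ if and only if \[\nu\left(\bigcup_{i\in I} A_i\right)\ge \sum_{i\in I} m_i\] for all $I \subseteq [n]$.
   Context: Notation: $[n] = \{1, 2, \dots, n\}$. A measure space $(\Omega, S, \nu)$ is finite if $\nu(\Omega) < \infty$. An atom of $\nu$ is a set $A \in S$ with $\nu(A) > 0$ such that for all $C \in S$ with $C \subset A$, either $\nu(C) = 0$ or $\nu(C) = \nu(A)$. The measure space $(\Omega, S, \nu)$ is called non-atomic if it has no atoms; equivalently, for every measurable set $A$ with $\nu(A) > 0$ there is a measurable subset $B \subseteq A$ with $\nu(A) > \nu(B) > 0$. *)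

(* Defs.v *)
From mathcomp Require Import all_boot all_order all_algebra.
From mathcomp Require Import all_classical all_reals all_analysis.

Set Implicit Arguments.
Unset Strict Implicit.
Unset Printing Implicit Defensive.

Local Open Scope classical_set_scope.
Local Open Scope ring_scope.
Local Open Scope ereal_scope.

Definition atom (d : measure_display) (T : measurableType d) (R : realType)
    (nu : set T -> \bar R) (X : set T) : Prop :=
  [/\ measurable X, 0 < nu X &
      forall C : set T, measurable C -> C `<=` X -> nu C = 0 \/ nu C = nu X].

Definition non_atomic (d : measure_display) (T : measurableType d)
    (R : realType) (nu : set T -> \bar R) : Prop :=
  forall X : set T, ~ atom nu X.

(* Main.v *)
(** For sufficiency of the condition, cut the space into the cells of the Venn
    diagram of the [A_ i].  Only the measures of the cells matter, and the condition
    becomes the fractional Hall condition for a finite bipartite graph joining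
    the cell [s] (a set of indices) to the indices [i \in s].  Fractional Hall is
    proved by deleting edges one at a time, after transporting along the edge an
    amount which keeps the condition true; such an amount exists by
    submodularity.  The resulting masses are realised inside each cell by
    Sierpinski's theorem: a finite non-atomic measure takes all intermediate
    values on subsets of a given set. *)

Require Import Defs.
From mathcomp Require Import all_boot all_order all_algebra.
From mathcomp Require Import all_classical all_reals all_analysis.
From mathcomp Require Import lra.

Set Implicit Arguments.
Unset Strict Implicit.
Unset Printing Implicit Defensive.

Import Order.TTheory GRing.Theory Num.Theory.
Import numFieldNormedType.Exports.
Local Open Scope classical_set_scope.
Local Open Scope ring_scope.

(** * Fractional Hall theorem for finite bipartite graphs *)

Definition nbr (S I : finType) (e : S -> I -> bool) (K : {set I}) : pred S :=
  fun s => [exists i in K, e s i].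

(** Fractional form of Hall's marriage condition: [c s] is the supply at [s], [m i] the demand at
    [i]. *)
Definition hall (R : realFieldType) (S I : finType) (e : S -> I -> bool)
    (c : S -> R) (m : I -> R) : Prop :=
  forall K : {set I}, \sum_(i in K) m i <= \sum_(s | nbr e K s) c s.

Definition del_edge (S I : finType) (e : S -> I -> bool) (s0 : S) (i0 : I)
    (s : S) (i : I) : bool := e s i && ((s, i) != (s0, i0)).

Lemma sum_pred_sub1 (R : realFieldType) (S : finType) (P : pred S) (c : S -> R)
    (s0 : S) (t : R) :
  \sum_(s | P s) (c s - t *+ (s == s0)) = \sum_(s | P s) c s - t *+ P s0.
Proof.
rewrite sumrB; congr (_ - _); case Ps: (P s0).
  rewrite (bigD1 s0)//= eqxx big1 ?addr0// => s /andP[_ /negPf ->].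
  by rewrite mulr0n.
rewrite big1 // => s Hs; case: eqP => // se; by rewrite se Ps in Hs.
Qed.

Section edge.
Context (R : realFieldType) (S I : finType) (e : S -> I -> bool).
Implicit Types (c : S -> R) (m : I -> R) (K L : {set I}).

Lemma nbrP K s : reflect (exists2 i, i \in K & e s i) (nbr e K s).
Proof. exact: exists_inP. Qed.

Variables (s0 : S) (i0 : I).
Hypothesis e0 : e s0 i0.
Let e' := del_edge e s0 i0.

Lemma nbr_del_edgeE K s : s != s0 \/ i0 \notin K -> nbr e' K s = nbr e K s.
Proof.
move=> H; apply: eq_existsb => i; rewrite /e' /del_edge xpair_eqE negb_and.
case: (boolP (i \in K)) => //= iK; case: H => [->|]; first by rewrite andbT.
move=> H; have -> : i != i0 by apply: contraNneq H => <-.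
by rewrite orbT andbT.
Qed.

Lemma nbr_del_edge_sub K s : nbr e' K s -> nbr e K s.
Proof.
by move=> /exists_inP[i iK /andP[ei _]]; apply/exists_inP; exists i.
Qed.

Lemma nbrU K L s : nbr e (K :|: L) s = nbr e K s || nbr e L s.
Proof.
apply/nbrP/orP => [[i /setUP[iK|iL] ei]|[]/nbrP[i iK ei]].
- by left; apply/nbrP; exists i.
- by right; apply/nbrP; exists i.
- by exists i => //; rewrite inE iK.
- by exists i => //; rewrite inE iK orbT.
Qed.

Lemma nbrS K L s : K \subset L -> nbr e K s -> nbr e L s.
Proof.
by move=> /fintype.subsetP KL /nbrP[i /KL iL ei]; apply/nbrP; exists i.
Qed.

(* The transported amount [t] must lie above [m K - c (N' K)] and below
   [c s0], [m i0] and [c (N L) - m L]; submodularity of [c (N _)] makes each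
   lower bound at most each upper bound. *)
Lemma transport_exists c m : (forall s, 0 <= c s) -> (forall i, 0 <= m i) ->
  hall e c m ->
  exists t, [/\ 0 <= t, t <= c s0, t <= m i0,
    forall K, i0 \in K ->
      \sum_(i in K) m i - \sum_(s | nbr e' K s) c s <= t &
    forall L, i0 \notin L -> nbr e L s0 ->
      t <= \sum_(s | nbr e L s) c s - \sum_(i in L) m i].
Proof.
move=> c0 m0 H.
(* The largest lower bound is taken; the default [0] of the maximum gives [0 <= t]. *)
exists (\big[Num.max/0]_(K : {set I} | i0 \in K)
  (\sum_(i in K) m i - \sum_(s | nbr e' K s) c s)); split.
- exact: bigmax_ge_id.
- apply: bigmax_le => // K iK; rewrite lerBlDr (le_trans (H K))//.
  rewrite (bigD1 s0)/=; last by apply/nbrP; exists i0.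
  rewrite lerD2l [leRHS]big_mkcond [leLHS]big_mkcond; apply: ler_sum => s _.
  case: ifP => [/andP[NKs ss0]|_]; last by case: ifP.
  by rewrite nbr_del_edgeE ?NKs//; left.
(* Hall's condition is used at [K :\ i0], all of whose edges survive the deletion. *)
- apply: bigmax_le => // K iK; rewrite (bigD1 i0)//= lerBlDr lerD2l.
  have -> : \sum_(i in K | i != i0) m i = \sum_(i in K :\ i0) m i.
    by apply: eq_bigl => i; rewrite !inE andbC.
  apply: (le_trans (H _)); rewrite [leRHS]big_mkcond [leLHS]big_mkcond.
  apply: ler_sum => s _.
  case: ifP => [|_]; last by case: ifP.
  rewrite -nbr_del_edgeE ?setD11; last by right.
  move=> /exists_inP[i]; rewrite !inE => /andP[_ iK'] ei.
  suff -> : nbr e' K s by [].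
  by apply/exists_inP; exists i.
- by move=> K iK; apply: le_bigmax_cond.
- move=> L iL NL.
  apply: bigmax_le => [|K iK]; first by rewrite subr_ge0.
  rewrite lerBlDr addrAC lerBrDr.
  (* The demand sums are modular in the set, so only an inequality between supplies remains, checked
     vertex by vertex. *)
  have := lerD (H (K :|: L)) (H (K :&: L)).
  have -> : \sum_(i in K :|: L) m i + \sum_(i in K :&: L) m i =
      \sum_(i in K) m i + \sum_(i in L) m i.
    rewrite !(big_mkcond (fun i => i \in _))/= -!big_split/=.
    apply: eq_bigr => i _; rewrite !inE.
    by case: (i \in K); case: (i \in L); rewrite /= ?addr0 ?add0r.
  move=> /le_trans; apply.
  rewrite !(big_mkcond (fun s => nbr _ _ s))/= -!big_split/=.
  apply: ler_sum => s _; rewrite nbrU.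
  have [->|ss0] := eqVneq s s0.
    (* As [i0 \notin L], an edge from [s0] into [K :&: L] is not the deleted one, so [s0] still
       counts in [nbr e' K]. *)
    rewrite NL orbT; have [|_] := boolP (nbr e (K :&: L) s0).
      rewrite -nbr_del_edgeE ?inE ?(negPf iL) ?andbF; last by right.
      move=> /exists_inP[i]; rewrite inE => /andP[iK' _] ei.
      suff -> : nbr e' K s0 by rewrite lexx.
      by apply/exists_inP; exists i.
    by case: ifP => _; rewrite ?add0r ?addr0 // lerDl c0.
  rewrite nbr_del_edgeE; last by left.
  have [NKL|_] := boolP (nbr e (K :&: L) s).
    by rewrite !(nbrS _ NKL) ?subsetIl ?subsetIr.
  by case: (nbr e K s); case: (nbr e L s); rewrite /= ?addr0 ?add0r ?lerDl.
Qed.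

(** The left side loses [t] when [i0 \in K], the right side when [nbr e' K s0]. If both or neither
    do, the old condition suffices; the two mixed cases are the lower and upper bounds on [t]. *)
Lemma hall_del_edge c m : (forall s, 0 <= c s) -> (forall i, 0 <= m i) ->
  hall e c m ->
  exists t, [/\ 0 <= t, t <= c s0, t <= m i0 &
    hall e' (fun s => c s - t *+ (s == s0)) (fun i => m i - t *+ (i == i0))].
Proof.
move=> c0 m0 H; have [t [t0 tc tm tl tu]] := transport_exists c0 m0 H.
exists t; split => // K; rewrite !sum_pred_sub1.
have [iK|iK] := boolP (i0 \in K).
  have [N's0|N's0] := boolP (nbr e' K s0).
    rewrite lerD2r (le_trans (H K))// le_eqVlt; apply/orP; left; apply/eqP.
    apply: eq_bigl => s; have [->|ss0] := eqVneq s s0.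
      by rewrite N's0 nbr_del_edge_sub.
    by rewrite nbr_del_edgeE//; left.
  by have := tl _ iK; rewrite mulr1n mulr0n; lra.
rewrite mulr0n subr0.
have NE : nbr e' K =1 nbr e K by move=> s; rewrite nbr_del_edgeE//; right.
rewrite (eq_bigl _ _ NE) NE.
have [Ns0|_] := boolP (nbr e K s0); last by rewrite mulr0n subr0.
by have := tu _ iK Ns0; rewrite mulr1n; lra.
Qed.

End edge.

(** Induction on the number of edges: the solution for the smaller graph is completed by putting [t]
    back on the deleted edge. *)
Lemma fractional_hall (R : realFieldType) (S I : finType) (e : S -> I -> bool)
    (c : S -> R) (m : I -> R) :
  (forall s, 0 <= c s) -> (forall i, 0 <= m i) -> hall e c m ->
  exists x : S -> I -> R,
    [/\ forall s i, 0 <= x s i,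
        forall s i, ~~ e s i -> x s i = 0,
        forall s, \sum_i x s i <= c s &
        forall i, \sum_s x s i = m i].
Proof.
have [k] := ubnP #|[set p : S * I | e p.1 p.2]%SET|.
elim: k e c m => // k IH e c m ltk c0 m0 H.
have [/existsP[[s0 i0] /= e0]|/existsPn noe] :=
    boolP [exists p : S * I, e p.1 p.2]; last first.
  (* Without edges, Hall's condition on singletons forces every demand to be zero. *)
  exists (fun _ _ => 0); split => // [s|i]; first by rewrite big1.
  rewrite big1//; apply/eqP; rewrite eq_le m0/=.
  have := H [set i]%SET; rewrite big_set1 big_pred0 // => s.
  by apply/existsPn => j; rewrite negb_and (noe (s, j)) orbT.
have [t [t0 tc tm H']] := hall_del_edge e0 c0 m0 H.
have := IH _ _ _ _ _ _ H'; case.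
- apply: leq_trans (_ : #|[set p : S * I | e p.1 p.2]%SET| <= k)%N; last first.
    by rewrite -ltnS.
  apply: proper_card; apply/properP; split.
    by apply/fintype.subsetP => -[s i]; rewrite !inE => /andP[].
  by exists (s0, i0); rewrite !inE //= /del_edge eqxx andbF.
- by move=> s; case: eqP => [->|_]; rewrite ?mulr1n ?mulr0n ?subr0 ?subr_ge0.
- by move=> s; case: eqP => [->|_]; rewrite ?mulr1n ?mulr0n ?subr0 ?subr_ge0.
move=> x [x0 xe xc xm].
exists (fun s i => x s i + t *+ ((s == s0) && (i == i0))); split.
- by move=> s i; rewrite addr_ge0// mulrn_wge0.
- move=> s i es; rewrite xe ?/del_edge ?(negPf es)// add0r.
  by case: eqP => // ss; case: eqP => // ii; rewrite ss ii e0 in es.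
- move=> s; have := xc s; rewrite lerBrDr; apply: le_trans.
  rewrite big_split lerD2l /= (bigD1 i0)//= big1 ?addr0 ?eqxx ?andbT//.
  by move=> i /negPf ->; rewrite andbF.
- move=> i; rewrite big_split /= xm (bigD1 s0)//= eqxx big1 ?addr0 ?subrK//.
  by move=> s /negPf ->.
Qed.

(** * Finite measures, exhaustion and Sierpinski's theorem *)

Section finite_measure.
Context (d : measure_display) (T : measurableType d) (R : realType).
Context (nu : {finite_measure set T -> \bar R}).
Implicit Types X Y Z : set T.

Local Notation r X := (fine (nu X)).

Lemma fine_measureE X : measurable X -> (r X)%:E = nu X.
Proof. by move=> mX; rewrite fineK// fin_num_measure. Qed.

Lemma le_fine_measure X Y : measurable X -> measurable Y -> X `<=` Y ->
  r X <= r Y.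
Proof.
by move=> mX mY XY; rewrite -lee_fin !fine_measureE// le_measure// inE.
Qed.

Lemma fine_measureD X Y : measurable X -> measurable Y -> X `<=` Y ->
  r (Y `\` X) = r Y - r X.
Proof.
move=> mX mY XY; apply/EFin_inj; rewrite EFinB !fine_measureE//; last first.
  exact: measurableD.
rewrite measureD//; first by rewrite (setIidr XY).
by rewrite ltey_eq fin_num_measure.
Qed.

Lemma measure_bigcup_pred (I : finType) (P : {pred I}) (F : I -> set T) :
  (forall i, P i -> measurable (F i)) -> trivIset [set` P] F ->
  nu (\bigcup_(i in [set` P]) F i) = (\sum_(i | P i) nu (F i))%E.
Proof.
move=> mF tF; rewrite measure_fin_bigcup//.
rewrite -(@bigfs _ _ _ _ (index_enum I)) ?index_enum_uniq// => i _.
by rewrite mem_index_enum.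
Qed.

Lemma fine_measureU X Y : measurable X -> measurable Y -> X `&` Y = set0 ->
  r (X `|` Y) = r X + r Y.
Proof.
move=> mX mY XY; apply/EFin_inj; rewrite EFinD !fine_measureE ?measureU//.
exact: measurableU.
Qed.

Lemma cvg_fine_measure_bigcup (G : nat -> set T) :
  (forall k, measurable (G k)) ->
  {homo G : i j / (i <= j)%N >-> i `<=` j} ->
  r (G k) @[k --> \oo] --> r (\bigcup_k G k).
Proof.
move=> mG Gle; have mU : measurable (\bigcup_k G k) by exact: bigcup_measurable.
apply: fine_cvg; rewrite fine_measureE//.
apply: nondecreasing_cvg_mu => // i j ij; apply/subsetPset; exact: Gle.
Qed.

(* Picking, at each step, an extension of measure at least halfway to the
   supremum, the union of the resulting chain cannot be enlarged. *)
Lemma exhaustion (F : set (set T)) (X0 : set T) :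
  F X0 -> (forall X, F X -> measurable X) ->
  (forall G : nat -> set T, (forall k, F (G k)) ->
     {homo G : i j / (i <= j)%N >-> i `<=` j} -> F (\bigcup_k G k)) ->
  exists2 Y, F Y & forall Z, F Z -> Y `<=` Z -> r Z <= r Y.
Proof.
move=> F0 mF clF.
have step (Y : {Y | F Y}) : exists Y' : {Y | F Y}, sval Y `<=` sval Y' /\
    forall Z, F Z -> sval Y `<=` Z -> r Z + r (sval Y) <= r (sval Y') *+ 2.
  case: Y => Y FY /=.
  pose E := [set r Z | Z in [set Z | F Z /\ Y `<=` Z]].
  have Eub : has_ubound E.
    exists (r setT) => _ [Z [FZ _] <-].
    by apply: le_fine_measure => //; apply: mF.
  have Esup : has_sup E by split=> //; exists (r Y); exists Y => //; split.
  have YE : r Y <= sup E by apply: ub_le_sup => //; exists Y => //; split.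
  (* A maximal [Y] extends itself; otherwise [sup E] exceeds [r Y], and half of the gap is a
     positive tolerance. *)
  have [FYZ|/existsNP[Z]] := pselect (forall Z, F Z -> Y `<=` Z -> r Z <= r Y).
    exists (exist _ Y FY); split=> //= Z FZ YZ.
    by rewrite mulr2n lerD2r FYZ.
  move=> /not_implyP[FZ /not_implyP[YZ /negP]]; rewrite -ltNge => ZY.
  have ZE : r Z <= sup E by apply: ub_le_sup => //; exists Z => //; split.
  have eps : 0 < (sup E - r Y) / 2 by rewrite divr_gt0// subr_gt0; lra.
  have [_ [Y' [FY' YY'] <-] Y'E] := sup_adherent eps Esup.
  exists (exist _ Y' FY'); split=> //= W FW YW.
  have WE : r W <= sup E by apply: ub_le_sup => //; exists W => //; split.
  rewrite mulr2n; lra.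
have [next nextP] := choice step.
pose G k := sval (iter k next (exist _ X0 F0)).
have FG k : F (G k) by rewrite /G; case: (iter _ _ _).
have GS k : G k `<=` G k.+1 by have [] := nextP (iter k next (exist _ X0 F0)).
have Gle : {homo G : i j / (i <= j)%N >-> i `<=` j}.
  move=> i j; elim: j => [|j IH]; first by rewrite leqn0 => /eqP ->.
  rewrite leq_eqVlt => /orP[/eqP -> //|]; rewrite ltnS => /IH H.
  exact: subset_trans (GS j).
have FU := clF _ FG Gle; exists (\bigcup_k G k) => // Z FZ UZ.
have mU := mF _ FU.
have GU k : r (G k) <= r (\bigcup_k G k).
  by apply: le_fine_measure; [exact: mF|by []|exact: bigcup_sup].
have cvgG : (fun k => r (G k)) @ \oo --> r (\bigcup_k G k).
  by apply: cvg_fine_measure_bigcup => // k; apply: mF.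
(* The halfway property gives [r Z + r (G k) <= 2 * r (G k.+1)], at most twice the measure of the
   union; the limit in [k] yields the claim. *)
have : lim (r (G k) @[k --> \oo]) <= r (\bigcup_k G k) *+ 2 - r Z.
  apply: limr_le; first by apply/cvg_ex; exists (r (\bigcup_k G k)).
  apply: nearW => k; have [_ /(_ Z FZ)] := nextP (iter k next (exist _ X0 F0)).
  have GZ : G k `<=` Z by apply: subset_trans UZ; exact: bigcup_sup.
  move=> /(_ GZ); rewrite -iterS -/(G k) -/(G k.+1) => H.
  rewrite lerBrDl (le_trans H)// lerMn2r GU orbT//.
have -> := cvg_lim (@Rhausdorff R) cvgG.
by rewrite mulr2n; lra.
Qed.

Hypothesis nu_na : non_atomic nu.

Lemma non_atomic_split X : measurable X -> 0 < r X ->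
  exists C, [/\ measurable C, C `<=` X, 0 < r C & r C < r X].
Proof.
move=> mX X0; apply: contrapT => nC; apply: (nu_na (X := X)).
split=> //; first by rewrite -fine_measureE.
move=> C mC CX; rewrite -(fine_measureE mC) -(fine_measureE mX).
have [C0|C0] := ltP 0 (r C); last first.
  by left; congr EFin; apply/eqP; rewrite eq_le C0 fine_ge0.
right; congr EFin; apply/eqP; rewrite eq_le le_fine_measure//= leNgt.
by apply/negP => CX'; apply: nC; exists C.
Qed.

(** One of [C] and its complement in [X] has at most half the measure. *)
Lemma non_atomic_halve X : measurable X -> 0 < r X ->
  exists C, [/\ measurable C, C `<=` X, 0 < r C & r C *+ 2 <= r X].
Proof.
move=> mX X0; have [C [mC CX C0 CltX]] := non_atomic_split mX X0.
have [H|H] := leP (r C *+ 2) (r X); first by exists C.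
have mXC : measurable (X `\` C) by exact: measurableD.
exists (X `\` C); rewrite fine_measureD//; split=> //; first lra.
by move: H; rewrite !mulr2n; lra.
Qed.

Lemma non_atomic_small X (eps : R) : measurable X -> 0 < r X -> 0 < eps ->
  exists C, [/\ measurable C, C `<=` X, 0 < r C & r C < eps].
Proof.
move=> mX X0 eps0.
have H k : exists C, [/\ measurable C, C `<=` X, 0 < r C & r C * 2 ^+ k <= r X].
  elim: k => [|k [C [mC CX C0 CleX]]].
    by exists X; rewrite expr0 mulr1; split.
  have [D [mD DC D0 DleC]] := non_atomic_halve mC C0.
  exists D; split=> //; first exact: subset_trans DC CX.
  by rewrite exprS mulrA mulr_natr (le_trans _ CleX)// ler_wpM2r// exprn_ge0.
(* This number of halvings makes [2 ^+ k] exceed [r X / eps], by [upper_nthrootP]. *)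
have [C [mC CX C0 CleX]] := H (Num.bound (r X / eps)).
exists C; split=> //; have := upper_nthrootP (leqnn (Num.bound (r X / eps))).
rewrite ltr_pdivrMr// mulrC => /(le_lt_trans CleX).
by rewrite ltr_pM2r// exprn_gt0.
Qed.

(** Exhaustion gives a maximal [Y] among the subsets of measure at most [t]. If [r Y < t], a small
    enough piece of [X] outside [Y] could be added, against maximality. *)
Lemma sierpinski X (t : R) : measurable X -> 0 <= t <= r X ->
  exists Y, [/\ measurable Y, Y `<=` X & r Y = t].
Proof.
move=> mX /andP[t0 tX].
have [||G FG Gle|Y [mY YX Yt] Ymax] :=
    @exhaustion [set Y | [/\ measurable Y, Y `<=` X & r Y <= t]] set0.
- by split=> //; rewrite measure0.
- by move=> Y [].
- have mG k : measurable (G k) by have [] := FG k.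
  split; first exact: bigcup_measurable.
    by move=> x [k _]; have [_ + _] := FG k; apply.
  have cG := cvg_fine_measure_bigcup mG Gle.
  rewrite -(cvg_lim (@Rhausdorff R) cG); apply: limr_le.
    by apply/cvg_ex; exists (r (\bigcup_k G k)).
  by apply: nearW => k; have [] := FG k.
exists Y; split=> //; apply/eqP; rewrite eq_le Yt/= leNgt; apply/negP => Ylt.
have mXY : measurable (X `\` Y) by exact: measurableD.
have XY0 : 0 < r (X `\` Y) by rewrite fine_measureD//; lra.
have tY : 0 < t - r Y by rewrite subr_gt0.
have [Z [mZ ZXY Z0 Zlt]] := non_atomic_small mXY XY0 tY.
have YZ : r (Y `|` Z) = r Y + r Z.
  by apply: fine_measureU => //; rewrite -subset0 => x [Yx /ZXY[]].
have : r (Y `|` Z) <= r Y.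
  apply: Ymax; last exact: subsetUl.
  split; [exact: measurableU| |by rewrite YZ; lra].
  by rewrite subUset; split=> // x /ZXY[].
by rewrite YZ; lra.
Qed.

(** The pieces are carved out one after another, each from what the previous ones leave of [X]. *)
Lemma sierpinski_seq (I : eqType) (s : seq I) (x : I -> R) X :
  uniq s -> measurable X -> (forall i, 0 <= x i) -> \sum_(i <- s) x i <= r X ->
  exists Q : I -> set T,
    [/\ forall i, i \in s -> measurable (Q i),
        forall i, i \in s -> Q i `<=` X,
        forall i, i \in s -> r (Q i) = x i &
        trivIset [set` s] Q].
Proof.
move=> us mX x0; elim: s us X mX => [_ X _ _|a s IH /= /andP[as_ us] X mX].
  by exists (fun=> set0); split.
rewrite big_cons => sumX.
have s0 : 0 <= \sum_(i <- s) x i by apply: sumr_ge0.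
have [|Y [mY YX Yx]] := @sierpinski X (x a) mX; first by rewrite x0/=; lra.
have mXY : measurable (X `\` Y) by exact: measurableD.
have [|Q [mQ QX Qx tQ]] := IH us _ mXY.
  by rewrite fine_measureD// Yx; lra.
have neq i : i \in s -> (i == a) = false.
  by move=> si; apply: contraNF as_ => /eqP <-.
exists (fun i => if i == a then Y else Q i); split.
- by move=> i; rewrite inE; case: eqP => //= _ /mQ.
- move=> i; rewrite inE; case: eqP => //= _ /QX H; apply: subset_trans H _.
  by move=> ? [].
- by move=> i; rewrite inE; case: eqP => [->//|_ /Qx].
- move=> i j /=; rewrite !inE; case: eqP => [->|_]; case: eqP => [->|_] //=.
  + by move=> _ js [z [Yz /(QX _ js)[]]].
  + by move=> is_ _ [z [/(QX _ is_)[_ nY] /nY]].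
  + exact: tQ.
Qed.

End finite_measure.

(** * Cells of the Venn diagram *)

Section venn.
Context (d : measure_display) (T : measurableType d) (I : finType).
Context (A_ : I -> set T).

(** The empty [s] gives the region outside all [A_ i]; it is adjacent to no index. *)
Definition cell (s : {set I}) : set T :=
  \bigcap_(i in [set: I]) (if i \in s then A_ i else ~` A_ i).

Lemma cellP (s : {set I}) x : cell s x <-> forall i, i \in s <-> A_ i x.
Proof.
split=> [sx i|H i _].
  by have := sx i Logic.I; case: (i \in s) => //= nA; split.
by case: ifPn => [/H//|/negP is_ /H].
Qed.

Lemma cell_mem (s : {set I}) i x : i \in s -> cell s x -> A_ i x.
Proof. by move=> si /cellP/(_ i)[+ _]; apply. Qed.

Lemma trivIset_cell (D : set {set I}) : trivIset D cell.
Proof.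
move=> s s' _ _ [x [/cellP sx /cellP sx']]; apply/setP => i.
by apply/idP/idP => [/sx/sx'|/sx'/sx].
Qed.

(** This identifies the measure of a union with the supply of a neighbourhood, turning the measure
    condition into [hall]. *)
Lemma bigcup_cell (K : {set I}) :
  \bigcup_(i in [set` K]) A_ i =
  \bigcup_(s in [set` nbr (fun (s : {set I}) i => i \in s) K]) cell s.
Proof.
apply/seteqP; split=> [x [i iK Ax]|x [s /exists_inP[i iK si] sx]].
  (* The cell of [x] is indexed by all [j] with [A_ j x]. *)
  have sP j : j \in [set j | `[< A_ j x >]]%SET <-> A_ j x.
    by rewrite inE; split=> [/asboolP|/asboolP].
  exists [set j | `[< A_ j x >]]%SET; last exact/cellP.
  by apply/exists_inP; exists i => //; apply/sP.
by exists i => //; exact: cell_mem sx.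
Qed.

Hypothesis mA_ : forall i, measurable (A_ i).

Lemma measurable_cell s : measurable (cell s).
Proof.
apply: fin_bigcap_measurable => // i _; case: ifP => // _.
exact: measurableC.
Qed.

End venn.

(** * The equivalence for systems of measurable sets *)

Local Open Scope ereal_scope.

Theorem theorem1p1 (d : measure_display) (T : measurableType d) (R : realType)
    (nu : {finite_measure set T -> \bar R}) (nu_na : non_atomic nu)
    (A : set T) (mA : measurable A) (A_gt0 : 0 < nu A)
    (n : nat) (n_ge1 : (1 <= n)%N)
    (A_ : 'I_n -> set T) (mA_ : forall i : 'I_n, measurable (A_ i))
    (A_sub : forall i : 'I_n, A_ i `<=` A)
    (m : 'I_n -> R) (m_gt0 : forall i : 'I_n, (0 < m i)%R) :
  (exists B : 'I_n -> set T,
     [/\ trivIset [set: 'I_n] B,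
         forall k : 'I_n, measurable (B k),
         forall k : 'I_n, B k `<=` A_ k &
         forall k : 'I_n, nu (B k) = (m k)%:E])
  <->
  (forall I : {set 'I_n},
     \sum_(i in I) (m i)%:E <= nu (\bigcup_(i in [set` I]) A_ i)).
Proof.
split=> [[B [tB mB BA nuB]] I|H].
  have -> : (\sum_(i in I) (m i)%:E = \sum_(i in I) nu (B i)).
    by apply: eq_bigr => i _; rewrite nuB.
  rewrite -measure_bigcup_pred//; last exact: sub_trivIset tB.
  apply: le_measure; rewrite ?inE; last exact: subset_bigcup.
    exact: fin_bigcup_measurable.
  exact: fin_bigcup_measurable.
pose P := cell A_; have mP s : measurable (P s) by exact: measurable_cell.
pose c s := fine (nu (P s)); pose e := fun (s : {set 'I_n}) i => i \in s.
have hallm : hall e c m.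
  move=> K; rewrite -lee_fin -!sumEFin.
  rewrite (eq_bigr (fun s => nu (P s))); last first.
    by move=> s _; exact: fine_measureE.
  rewrite -measure_bigcup_pred//; last exact: trivIset_cell.
  by rewrite -bigcup_cell; exact: H.
(* [x s i] is the mass that the set for index [i] takes from the cell [s]. *)
have [x [x0 xe xc xm]] : exists x : {set 'I_n} -> 'I_n -> R,
    [/\ forall s i, (0 <= x s i)%R, forall s i, ~~ e s i -> x s i = 0%R,
        forall s, (\sum_i x s i <= c s)%R & forall i, (\sum_s x s i = m i)%R].
  apply: fractional_hall hallm => [s|i]; first exact: fine_ge0.
  exact: ltW.
(* The row bound [xc s] is what lets disjoint pieces of masses [x s i] fit inside the cell [s]. *)
have [Q QP] := choice (fun s => sierpinski_seq nu_na
  (index_enum_uniq 'I_n) (mP s) (x0 s) (xc s)).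
have mQ s i : measurable (Q s i).
  by have [+ _ _ _] := QP s; apply; rewrite mem_index_enum.
have QsubP s i : Q s i `<=` P s.
  by have [_ + _ _] := QP s; apply; rewrite mem_index_enum.
have Qx s i : nu (Q s i) = (x s i)%:E.
  rewrite -(fine_measureE nu (mQ s i)); congr EFin.
  by have [_ _ + _] := QP s; apply; rewrite mem_index_enum.
(* Only cells with [k \in s] are collected, which keeps the union inside [A_ k]. *)
exists (fun k => \bigcup_(s in [set` [pred s | e s k]]) Q s k); split.
- move=> i j _ _ [y [[s _ Qy] [s' _ Q'y]]].
  (* Pieces that meet lie in the same cell, where the [Q s i] are disjoint. *)
  have ss' : s = s'.
    apply: (@trivIset_cell _ _ _ A_ setT) => //.
    by exists y; split; [exact: QsubP Qy|exact: QsubP Q'y].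
  rewrite -ss' in Q'y; have [_ _ _ tQ] := QP s.
  by apply: tQ; rewrite /= ?mem_index_enum//; exists y.
- by move=> k; exact: fin_bigcup_measurable.
- by move=> k y [s sk /QsubP]; exact: cell_mem.
- move=> k; rewrite measure_bigcup_pred//; last first.
    move=> s s' _ _ [y [/QsubP Py /QsubP P'y]].
    by apply: (@trivIset_cell _ _ _ A_ setT) => //; exists y.
  rewrite (eq_bigr (fun s => (x s k)%:E)); last by move=> s _; exact: Qx.
  (* No mass is lost: by [xe], the omitted cells contribute zero to [m k]. *)
  rewrite sumEFin -xm [in RHS](bigID [pred s | e s k])/=.
  by rewrite [X in (_ + X)%R]big1 ?addr0// => s; exact: xe.
Qed.
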